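(* Let $\gamma\in[0,1)$ and $L_f,L_r,L_\pi\ge 0$ with $\gamma L_f(1+L_\pi)<1$. Let $\alpha,\beta>0$, $A_d,A_r>0$, $c_{\mathrm{dyn}},c_{\mathrm{rew}}>0$ and $B>0$, and for $N_{\mathrm{dyn}},N_{\mathrm{rew}}>0$ put $$\varepsilon_{\mathrm{dyn}}(N_{\mathrm{dyn}})=A_d\,N_{\mathrm{dyn}}^{-\alpha},\qquad \varepsilon_{\mathrm{rew}}(N_{\mathrm{rew}})=A_r\,N_{\mathrm{rew}}^{-\beta}.$$ Let $(N_{\mathrm{dyn}}^*,N_{\mathrm{rew}}^* )$ be a minimizer of $$\frac{1}{1-\gamma}\,\varepsilon_{\mathrm{rew}}(N_{\mathrm{rew}})+\frac{\gamma L_r(1+L_\pi)}{(1-\gamma)(1-\gamma L_f(1+L_\pi))}\,\varepsilon_{\mathrm{dyn}}(N_{\mathrm{dyn}})$$ over all real $N_{\mathrm{dyn}},N_{\mathrm{rew}}>0$ satisfying $c_{\mathrm{dyn}}N_{\mathrm{dyn}}+c_{\mathrm{rew}}N_{\mathrm{rew}}=B$, and let $\varepsilon_{\mathrm{dyn}}^*:=\varepsilon_{\mathrm{dyn}}(N_{\mathrm{dyn}}^* )$, $\varepsilon_{\mathrm{rew}}^*:=\varepsilon_{\mathrm{rew}}(N_{\mathrm{rew}}^* )$. Then $$\frac{N_{\mathrm{dyn}}^*}{N_{\mathrm{rew}}^*}=\frac{\alpha}{\beta}\cdot\frac{\gamma L_r(1+L_\pi)}{1-\gamma L_f(1+L_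\pi)}\cdot\frac{c_{\mathrm{rew}}}{c_{\mathrm{dyn}}}\cdot\frac{\varepsilon_{\mathrm{dyn}}^*}{\varepsilon_{\mathrm{rew}}^*}.$$
   Context: $N_{\mathrm{dyn}}$ and $N_{\mathrm{rew}}$ are the numbers of dynamics-transition samples and reward samples (treated as positive real numbers), $c_{\mathrm{dyn}}$ and $c_{\mathrm{rew}}$ are their per-sample costs, and $B$ is the total budget. The objective is an upper bound on the gap in discounted return (discount $\gamma$) of an $L_\pi$-Lipschitz policy between a true Markov decision process with $L_f$-Lipschitz dynamics and $L_r$-Lipschitz reward and a learned one with worst-case dynamics error $\varepsilon_{\mathrm{dyn}}$ and worst-case reward error $\varepsilon_{\mathrm{rew}}$. *)

(* Defs.v *)
From Stdlib Require Import Reals.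
Open Scope R_scope.

(* Worst-case error after N samples.  Rpower N x is exp (x * ln N), hence the
   real power N^x only for N > 0. *)
Definition power_law_error (A p N : R) : R := A * Rpower N (- p).

(* Upper bound on the gap in discounted return between the true and the learned
   Markov decision process, for worst-case reward error eps_rew and worst-case
   dynamics error eps_dyn. *)
Definition return_gap_bound (gamma Lf Lr Lpi eps_rew eps_dyn : R) : R :=
  1 / (1 - gamma) * eps_rew
  + gamma * Lr * (1 + Lpi) / ((1 - gamma) * (1 - gamma * Lf * (1 + Lpi)))
    * eps_dyn.

Definition feasible (c_dyn c_rew B N_dyn N_rew : R) : Prop :=
  0 < N_dyn /\ 0 < N_rew /\ c_dyn * N_dyn + c_rew * N_rew = B.

Definition is_minimizer_on (P : R -> R -> Prop) (F : R -> R -> R) (x y : R)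
  : Prop :=
  P x y /\ forall x' y' : R, P x' y' -> F x y <= F x' y'.

(* Main.v *)
(** At a minimizer the objective is stationary along the budget line, whose
    direction is [(c_rew, - c_dyn)]; since [eps' (N) = - p * eps (N) / N] for a
    power law of exponent [p], the stationarity equation is the asserted ratio.
    When [gamma * Lr = 0] stationarity is contradictory, as it should be: no
    minimizer exists, and the same algebra applies. *)

Require Import Defs.
From Stdlib Require Import Reals Lra.
Open Scope R_scope.

(** The derivative is expressed through the error itself instead of [Rpower N (- p - 1)], so that
    stationarity directly relates the two optimal errors. *)
Lemma derivable_pt_lim_power_law_error (A p N : R) :
  0 < N ->
  derivable_pt_lim (power_law_error A p) N (- p * power_law_error A p N / N).
Proof.
intros HN.
assert (Hpow : Rpower N (- p - 1) = Rpower N (- p) / N).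
{ unfold Rminus. rewrite Rpower_plus, (Rpower_Ropp N 1), Rpower_1 by assumption.
  reflexivity. }
unfold power_law_error.
replace (- p * (A * Rpower N (- p)) / N)
  with (A * (- p * Rpower N (- p - 1))) by (rewrite Hpow; field; lra).
apply (derivable_pt_lim_scal (fun x => Rpower x (- p))).
now apply derivable_pt_lim_power.
Qed.

Lemma derivable_pt_lim_comp_affine (f : R -> R) (x c l : R) :
  derivable_pt_lim f x l ->
  derivable_pt_lim (fun t => f (x + c * t)) 0 (l * c).
Proof.
intros Hf.
apply (derivable_pt_lim_comp (fun t => x + c * t) f).
- assert (H : derivable_pt_lim (fun t => x + c * t) 0 (0 + c * 1));
    [ | now replace (0 + c * 1) with c in H by ring ].
  apply (derivable_pt_lim_plus (fun _ => x) (fun t => c * t)).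
  + apply derivable_pt_lim_const.
  + apply (derivable_pt_lim_scal (fun t => t)), derivable_pt_lim_id.
- now replace (x + c * 0) with x by ring.
Qed.

(** Fermat's rule for [h], the objective along [t -> (x + d * t, y - c * t)]: the cost stays equal
    to [B], and since [x] and [y] are positive, [t = 0] is interior to the feasible range. *)
Lemma minimizer_on_budget_line_stationary
    (f g : R -> R) (c d B x y f' g' : R) :
  0 < c -> 0 < d ->
  is_minimizer_on (feasible c d B) (fun u v => f u + g v) x y ->
  derivable_pt_lim f x f' -> derivable_pt_lim g y g' ->
  d * f' = c * g'.
Proof.
intros Hc Hd [(Hx & Hy & HB) Hmin] Hf Hg.
set (h := fun t => f (x + d * t) + g (y + - c * t)).
assert (Hh : derivable_pt_lim h 0 (f' * d + g' * - c)).
{ apply (derivable_pt_lim_plus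
           (fun t => f (x + d * t)) (fun t => g (y + - c * t)));
    now apply derivable_pt_lim_comp_affine. }
assert (Hstat : f' * d + g' * - c = 0).
(* With this witness, [derive_pt h 0 pr] is convertible to the value computed in [Hh]. *)
{ pose (pr := exist _ _ Hh : derivable_pt h 0).
  change (derive_pt h 0 pr = 0).
  (* The endpoints are where [x + d * t] and [y - c * t] vanish; strictly between them both
     coordinates are positive. *)
  apply (deriv_minimum h (- (x / d)) (y / c) 0 pr).
  - pose proof (Rdiv_lt_0_compat x d Hx Hd). lra.
  - now apply Rdiv_lt_0_compat.
  - intros t Hlo Hhi.
    apply (Rmult_lt_compat_l d) in Hlo; [ | assumption ].
    apply (Rmult_lt_compat_l c) in Hhi; [ | assumption ].
    replace (d * - (x / d)) with (- x) in Hlo by (field; lra).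
    replace (c * (y / c)) with y in Hhi by (field; lra).
    unfold h. rewrite !Rmult_0_r, !Rplus_0_r.
    apply Hmin. unfold feasible. repeat split; lra. }
lra.
Qed.

Theorem theorem1 :
  forall (gamma Lf Lr Lpi alpha beta A_d A_r c_dyn c_rew B : R),
    0 <= gamma < 1 ->
    0 <= Lf -> 0 <= Lr -> 0 <= Lpi ->
    gamma * Lf * (1 + Lpi) < 1 ->
    0 < alpha -> 0 < beta ->
    0 < A_d -> 0 < A_r ->
    0 < c_dyn -> 0 < c_rew -> 0 < B ->
    let eps_dyn := power_law_error A_d alpha in
    let eps_rew := power_law_error A_r beta in
    forall (N_dyn N_rew : R),
      is_minimizer_on
        (feasible c_dyn c_rew B)
        (fun n_dyn n_rew : R =>
           return_gap_bound gamma Lf Lr Lpi (eps_rew n_rew) (eps_dyn n_dyn))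
        N_dyn N_rew ->
      N_dyn / N_rew =
        alpha / beta
        * (gamma * Lr * (1 + Lpi) / (1 - gamma * Lf * (1 + Lpi)))
        * (c_rew / c_dyn)
        * (eps_dyn N_dyn / eps_rew N_rew).
Proof.
intros gamma Lf Lr Lpi alpha beta A_d A_r c_dyn c_rew B
  Hgamma _ _ _ Hcontr _ Hbeta _ HAr Hcd Hcr _ eps_dyn eps_rew
  N_dyn N_rew Hmin.
pose proof Hmin as [(HNd & HNr & _) _].
set (a := 1 / (1 - gamma)).
set (b := gamma * Lr * (1 + Lpi)
          / ((1 - gamma) * (1 - gamma * Lf * (1 + Lpi)))).
assert (Hstat : c_rew * (b * (- alpha * eps_dyn N_dyn / N_dyn))
                = c_dyn * (a * (- beta * eps_rew N_rew / N_rew))).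
{ apply (minimizer_on_budget_line_stationary
           (fun n => b * eps_dyn n) (fun n => a * eps_rew n)
           c_dyn c_rew B N_dyn N_rew); try assumption.
  - destruct Hmin as [Hfeas Hle].
    split; [ assumption | ].
    intros u v Huv. rewrite (Rplus_comm (b * _)), (Rplus_comm (b * eps_dyn u)).
    exact (Hle u v Huv).
  - now apply (derivable_pt_lim_scal eps_dyn), derivable_pt_lim_power_law_error.
  - now apply (derivable_pt_lim_scal eps_rew), derivable_pt_lim_power_law_error. }
assert (Her : 0 < eps_rew N_rew).
{ apply Rmult_lt_0_compat; [ assumption | apply exp_pos ]. }
set (ed := eps_dyn N_dyn) in *.
set (er := eps_rew N_rew) in *.
(* The first factor turns the right side of [Hstat] into [N_dyn / N_rew] and its left side into the
   claimed product. Nothing is divided by [b], so [b = 0] needs no separate case. *)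
transitivity (N_dyn * (1 - gamma) / (- c_dyn * beta * er)
              * (c_dyn * (a * (- beta * er / N_rew)))).
- unfold a. field. repeat split; lra.
- rewrite <- Hstat. unfold b. field. repeat split; lra.
Qed.
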